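(* Let $d\geq \ell>0$ be integers. There exists a bijection of sets $$S_{d,\ell}\longleftrightarrow S'_{d-\ell,\ell}$$ which preserves the positions of the two extremal cells (hand and foot) of the hooks: if $(\mu,g)\in S_{d,\ell}$ corresponds to $(\lambda,h)\in S'_{d-\ell,\ell}$, then the hooks $g$ and $h$ have the same north-east end cell and the same south-west end cell. In particular, the bijection preserves content sets and hook types of the hooks.
   Context: A partition $\lambda=(\lambda_1\geq\lambda_2\geq\dots)$ is a finite sequence of positive integers (extended by zeros), of size $|\lambda|=\sum_i\lambda_i$. Its Young diagram is the set of boxes (cells) $(i,j)\in\mathbb{Z}_{\geq 0}^2$ with $0\leq j<\lambda_{i+1}$; $i$ is the row index (increasing downwards, i.e. southwards) and $j$ the column index (increasing to the right, i.e. eastwards). Partitions are identified with their Young diagrams, and $\mathcal{P}_d$ is the set of Young diagrams of size $d$. The internal hook of $\lambda$ at $\Box=(i,j)\in\lambda$ is $H_\lambda(\Box)=\{(l,k)\in\lambda \mid l=i,\,k\geq j \text{ or } l\geq i,\,k=j\}$. The external hook of $\lambda$ at $\Box=(i,j)\in\mathbb{Z}_{\geq0}^2\setminus\lambda$ is $H_\lambda(\Box)=\{(l,k)\in\mathbb{Z}_{\geq0}^2\setminus\lambda\mid l=i,\,k\leq j\text{ or } l\leq i,\,k=j\}$. For $\Box=(i,j)\in\lambda$ the arm and leg lengths are $a_\lambda(\Box)=|\{(i,j')\in\lambda\mid j<j'\}|$ and $\ell_\lambda(\Box)=|\{(i',j)\in\lambda\mid i<i'\}|$. For $\Box=(i,j)\in\mathbb{Z}_{\ge0}^2\setminus\lambda$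 they are $a_\lambda(\Box)=|\{(i,j')\notin\lambda\mid 0\le j'<j\}|$ and $\ell_\lambda(\Box)=|\{(i',j)\notin\lambda\mid 0\le i'<i\}|$. The hook length is $h_\lambda(\Box)=a_\lambda(\Box)+\ell_\lambda(\Box)+1$ and the hook type of the hook at $\Box$ is the pair $(a_\lambda(\Box),\ell_\lambda(\Box))$. The content of a cell $(i,j)$ is $j-i$, and the content set of a hook $h$ is $\{j-i\mid(i,j)\in h\}$. The hand of a hook is the last cell at the end of its arm (horizontal part) and the foot is the last cell at the end of its leg (vertical part). For an internal hook the hand is its north-east end cell and the foot its south-west end cell; for an external hook the cell at the end of the leg is the north-east end cell and the cell at the end of the arm is the south-west end cell. Equivalently, for both kinds of hooks the north-east (resp. south-west) end cell is the cell of the hook of maximal (resp. minimal) content. For integers $d\geq 0$ and $\ell>0$, $$S_{d,\ell}=\{(\lambda,h)\mid\lambda\in\mathcal{P}_d,\ h\text{ an internal hook of }\lambda\text{ of hook length }\ell\},$$ $$S'_{d,\ell}=\{(\lambda,h)\mid\lambda\in\mathcal{P}_d,\ h\text{ an external hook of }\lambda\text{ of hook length }\ell\}.$$ *)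

(* Defs.v *)
From HB Require Import structures.
From mathcomp Require Import all_boot all_order all_algebra.
From mathcomp Require Import finmap.
From mathcomp Require Import mathcomp_extra boolp classical_sets functions.
From mathcomp Require Import cardinality.

Set Implicit Arguments.
Unset Strict Implicit.
Unset Printing Implicit Defensive.

Local Open Scope classical_set_scope.

Definition is_partition (s : seq nat) : bool :=
  sorted geq s && (0%N \notin s).

Record int_partition : Type := Partition {
  parts :> seq nat;
  partsP : is_partition parts }.

HB.instance Definition _ := [isSub for parts].
HB.instance Definition _ := [Choice of int_partition by <:].

Definition partitions_of (d : nat) : set int_partition :=
  [set la : int_partition | sumn la = d].

(* (i, j) is the cell in row i and column j, both counted from 0. *)
Definition cell : Type := (nat * nat)%type.

(* [nth 0] is the extension of the partition by zeros. *)
Definition in_diagram (la : int_partition) (b : cell) : bool :=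
  (b.2 < nth 0 la b.1)%N.

Definition internal_hook (la : int_partition) (b : cell) : set cell :=
  [set c | in_diagram la c /\
    ((c.1 = b.1 /\ (b.2 <= c.2)%N) \/ ((b.1 <= c.1)%N /\ c.2 = b.2))].

Definition external_hook (la : int_partition) (b : cell) : set cell :=
  [set c | ~~ in_diagram la c /\
    ((c.1 = b.1 /\ (c.2 <= b.2)%N) \/ ((c.1 <= b.1)%N /\ c.2 = b.2))].

Definition hook (la : int_partition) (b : cell) : set cell :=
  if in_diagram la b then internal_hook la b else external_hook la b.

(* [fset_set] returns the empty set on infinite sets; the two cardinals below
   are only taken of finite sets, being bounded by a row or column of la, or
   by the coordinates of b. *)
Definition arm (la : int_partition) (b : cell) : nat :=
  if in_diagram la b
  then #|` fset_set [set c : cell |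
             [/\ in_diagram la c, c.1 = b.1 & (b.2 < c.2)%N]] |
  else #|` fset_set [set c : cell |
             [/\ ~~ in_diagram la c, c.1 = b.1 & (c.2 < b.2)%N]] |.

Definition leg (la : int_partition) (b : cell) : nat :=
  if in_diagram la b
  then #|` fset_set [set c : cell |
             [/\ in_diagram la c, c.2 = b.2 & (b.1 < c.1)%N]] |
  else #|` fset_set [set c : cell |
             [/\ ~~ in_diagram la c, c.2 = b.2 & (c.1 < b.1)%N]] |.

Definition hook_length (la : int_partition) (b : cell) : nat :=
  (arm la b + leg la b).+1.

Definition hook_type (la : int_partition) (b : cell) : nat * nat :=
  (arm la b, leg la b).

Definition content (c : cell) : int := (c.2%:Z - c.1%:Z)%R.

Definition content_set (h : set cell) : set int := content @` h.

Definition is_ne_end (h : set cell) (c : cell) : Prop :=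
  h c /\ forall c', h c' -> c' <> c -> (content c' < content c)%R.

Definition is_sw_end (h : set cell) (c : cell) : Prop :=
  h c /\ forall c', h c' -> c' <> c -> (content c < content c')%R.

(* The corner b of an internal (resp. external) hook is determined by the set
   h, as its cell with the least (resp. greatest) coordinates. *)
Definition is_internal_hook_at (la : int_partition) (h : set cell) (b : cell) :
    Prop :=
  in_diagram la b /\ h = hook la b.

Definition is_external_hook_at (la : int_partition) (h : set cell) (b : cell) :
    Prop :=
  ~~ in_diagram la b /\ h = hook la b.

Definition S_int (d l : nat) : set (int_partition * set cell) :=
  [set x | partitions_of d x.1 /\
    exists2 b, is_internal_hook_at x.1 x.2 b & hook_length x.1 b = l].

Definition S_ext (d l : nat) : set (int_partition * set cell) :=
  [set x | partitions_of d x.1 /\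
    exists2 b, is_external_hook_at x.1 x.2 b & hook_length x.1 b = l].

(* Main.v *)
Require Import Defs.
From mathcomp Require Import all_boot all_order all_algebra.
From mathcomp Require Import finmap.
From mathcomp Require Import mathcomp_extra boolp classical_sets functions.
From mathcomp Require Import cardinality.
From mathcomp Require Import zify.

(** The bijection is the removal of a rim hook.  Let the internal hook of mu at
    (i, j) have hand (i, n) and foot (m, j).  The rim of mu contains exactly one
    connected strip from (m, j) to (i, n); it meets each diagonal that the hook
    meets, once, so it has as many cells as the hook.  Deleting the strip leaves
    a partition la whose row m has length j and whose column n has length i,
    that is, whose external hook at (m, n) has the ends (m, j) and (i, n).

    On row lengths, the deletion drops row i (of length n + 1), moves each of
    the rows i + 1, ..., m up by one place while shortening it by one cell, and
    inserts a row of length j at place m.  These equations, [rim_shift], can be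
    solved for either side.  The new row lengths decrease because row m of mu is
    longer than j and row m + 1 is not ([remove_rim_hook]); the old ones do
    because row i of la is at most n long and row i - 1 is longer
    ([add_rim_hook]).  So the conditions that place the ends of the internal
    hook of mu and of the external hook of la are exactly those under which the
    strip can be deleted or put back, and [rim_shift_sumn] gives the drop in
    size as the hook length.

    A hook is thus described by the rectangle with corners (i, j) and (m, n):
    an internal hook is its upper left border, an external one its lower right
    border.  The two borders have the same two ends, the same contents and the
    same arm and leg lengths; and the ends give the rectangle back, so that a
    hook given only as a set of cells determines its corner. *)

Local Open Scope classical_set_scope.

(** * Rows and columns of a partition *)

Definition row_len (la : int_partition) (i : nat) : nat := nth 0 la i.

(** The row lengths of the conjugate partition. *)
Definition col_len (la : int_partition) (j : nat) : nat := count (ltn j) la.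

(** A cell lies in the diagram of s exactly when its transpose lies in the
    diagram of the conjugate; rows and columns below are exchanged through this
    equivalence. *)
Lemma ltn_nth_count (s : seq nat) (i j : nat) :
  sorted geq s -> (j < nth 0 s i)%N = (i < count (ltn j) s)%N.
Proof.
have geq_tr : transitive geq by move=> a b c /=; lia.
elim: s i => [|x s IHs] i; first by rewrite nth_nil.
rewrite /= (path_sortedE geq_tr) => /andP[/allP xs ss].
case: (ltnP j x) => [jx|xj]; first by case: i => [|i] //=; rewrite IHs //; lia.
have -> : count (ltn j) s = 0.
  apply/eqP; rewrite -leqn0 leqNgt -has_count; apply/hasP => -[y ys /= jy].
  by have /= := xs y ys; lia.
case: i => [|i] /=; first by lia.
case: (ltnP i (size s)) => [lt_is|/(nth_default 0) -> //].
by have /= := xs _ (mem_nth 0 lt_is); lia.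
Qed.

Lemma partition_sorted (la : int_partition) : sorted geq la.
Proof. by have /andP[] := partsP la. Qed.

Lemma ltn_row_col (la : int_partition) (i j : nat) :
  (j < row_len la i)%N = (i < col_len la j)%N.
Proof. exact/ltn_nth_count/partition_sorted. Qed.

Lemma row_nonincreasing (la : int_partition) (i k : nat) :
  (i <= k)%N -> (row_len la k <= row_len la i)%N.
Proof.
move=> ik; rewrite leqNgt ltn_row_col -leqNgt.
by apply: leq_trans ik; rewrite leqNgt -ltn_row_col ltnn.
Qed.

Lemma col_unique (la : int_partition) (j c : nat) :
  (forall k, (j < row_len la k)%N = (k < c)%N) -> col_len la j = c.
Proof.
move=> h; have := h c; have := h (col_len la j); rewrite !ltn_row_col !ltnn.
by lia.
Qed.

Lemma row_eq0 (la : int_partition) (k : nat) : (row_len la k == 0) = (size la <= k)%N.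
Proof.
apply/eqP/idP => [r0|/(nth_default 0)//]; rewrite leqNgt.
apply/negP => lt_k; have /andP[_] := partsP la.
by rewrite -[X in X \notin _]r0 mem_nth.
Qed.

Lemma row_inj (la mu : int_partition) : row_len la =1 row_len mu -> la = mu.
Proof.
move=> eq_row; apply: val_inj; apply: (@eq_from_nth _ 0) => [|i _]; last exact: eq_row.
apply/eqP.
by rewrite eqn_leq -(row_eq0 la) -(row_eq0 mu) eq_row -(eq_row (size la)) !row_eq0 !leqnn.
Qed.

Lemma partition_of_rows (r : nat -> nat) (N : nat) :
  (forall k, r k.+1 <= r k)%N -> r N = 0 ->
  exists la : int_partition, row_len la =1 r.
Proof.
move=> r_decr rN; have ex0 : exists k, r k == 0 by exists N; rewrite rN.
have [p /eqP rp p_min] := ex_minnP ex0.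
have r_mono i k : (i <= k)%N -> (r k <= r i)%N.
  by elim: k => [|k IHk]; [case: i | have := r_decr k; case: (eqVneq i k.+1) => [->//|]; lia].
have s_part : is_partition (mkseq r p).
  apply/andP; split.
    apply/(sortedP 0) => i; rewrite size_mkseq => lt_ip.
    by rewrite !nth_mkseq //=; lia.
  apply/mapP => -[k]; rewrite mem_iota => /andP[_ lt_kp] /esym/eqP r0.
  by have := p_min k r0; lia.
exists (Partition s_part) => k; rewrite /row_len /=.
case: (ltnP k p) => [lt_kp|le_pk]; first by rewrite nth_mkseq.
by rewrite nth_default ?size_mkseq //; have := r_mono _ _ le_pk; lia.
Qed.

Lemma sumn_rows (la : int_partition) (N : nat) :
  (size la <= N)%N -> sumn la = \sum_(0 <= k < N) row_len la k.
Proof.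
move=> le_N; rewrite sumnE (big_nth 0) (big_cat_nat _ le_N) //=.
rewrite [X in _ = (_ + X)%N]big_nat_cond [X in _ = (_ + X)%N]big1 ?addn0 //.
by move=> k /andP[/andP[le_k _] _]; apply/eqP; rewrite row_eq0.
Qed.

(** * Removing and adding rim hooks *)

(** [r] and [r'] are the row lengths before and after deleting from the rim the
    strip that runs from the cell (m, j) up to the cell (i, n). *)
Definition rim_shift (i j m n : nat) (r r' : nat -> nat) : Prop :=
  [/\ forall k, (k < i)%N -> r k = r' k, r i = n.+1,
      forall k, (i <= k < m)%N -> r k.+1 = (r' k).+1, r' m = j
    & forall k, (m < k)%N -> r k = r' k].

Lemma rim_shift_fun i j m n r r1 r2 :
  rim_shift i j m n r r1 -> rim_shift i j m n r r2 -> r1 =1 r2.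
Proof.
move=> [a1 b1 c1 d1 e1] [a2 b2 c2 d2 e2] k.
have := a1 k; have := a2 k; have := c1 k; have := c2 k.
by have := e1 k; have := e2 k; case: (eqVneq k m) => [->|]; lia.
Qed.

Lemma rim_shift_inj i j m n r1 r2 r' :
  rim_shift i j m n r1 r' -> rim_shift i j m n r2 r' -> r1 =1 r2.
Proof.
move=> [a1 b1 c1 d1 e1] [a2 b2 c2 d2 e2] k.
have := a1 k; have := a2 k; have := c1 k.-1; have := c2 k.-1.
have := e1 k; have := e2 k; case: (eqVneq k i) => [->|]; first by lia.
by case: k => [|k] /=; lia.
Qed.

(** Rows i + 1, ..., m lose one cell each, and a row of n + 1 cells is traded for
    one of j cells: the loss is (m - i) + (n + 1 - j). *)
Lemma rim_shift_sumn i j m n (mu la : int_partition) :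
  (i <= m)%N -> (j <= n)%N -> rim_shift i j m n (row_len mu) (row_len la) ->
  sumn mu = (sumn la + ((n - j) + (m - i)).+1)%N.
Proof.
move=> im jn [before top middle bottom after].
pose N := maxn m.+1 (maxn (size mu) (size la)).
rewrite (@sumn_rows mu N) ?(@sumn_rows la N); try by rewrite /N; lia.
have mN : (m.+1 <= N)%N by rewrite /N; lia.
rewrite !(big_cat_nat (leq0n i) (leq_trans (leqW im) mN)) /=.
rewrite !(big_cat_nat (leqW im) mN) /=.
have -> : \sum_(0 <= k < i) row_len mu k = \sum_(0 <= k < i) row_len la k.
  by apply: eq_big_nat => k /andP[_]; apply: before.
have -> : \sum_(m.+1 <= k < N) row_len mu k = \sum_(m.+1 <= k < N) row_len la k.
  by apply: eq_big_nat => k /andP[mk _]; apply: after.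
rewrite [\sum_(i <= k < m.+1) row_len mu k]big_nat_recl //.
rewrite [\sum_(i <= k < m.+1) row_len la k]big_nat_recr //= top bottom.
have -> : \sum_(i <= k < m) row_len mu k.+1 =
          (\sum_(i <= k < m) row_len la k + (m - i))%N.
  rewrite (eq_big_nat _ _ middle); under eq_big_nat do rewrite -addn1.
  by rewrite big_split sum_nat_const_nat muln1.
lia.
Qed.

(** The row inserted at place m fits because row m of mu is longer than j while
    row m + 1 is not, which is what a column j of length m + 1 means.  Column n
    then stops at row i: everything from there on is at most n long. *)
Lemma remove_rim_hook i j m n (mu : int_partition) :
  (i <= m)%N -> (j <= n)%N -> row_len mu i = n.+1 -> col_len mu j = m.+1 ->
  exists2 la, rim_shift i j m n (row_len mu) (row_len la) & col_len la n = i.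
Proof.
move=> im jn mui muj.
have mono k k' := @row_nonincreasing mu k k'.
have below k : (j < row_len mu k)%N = (k <= m)%N by rewrite ltn_row_col muj.
pose r k := if (k < i)%N then row_len mu k else if (k < m)%N then (row_len mu k.+1).-1
            else if k == m then j else row_len mu k.
have r_decr k : (r k.+1 <= r k)%N.
  have := mono _ _ (leqnSn k); have := mono _ _ (leqnSn k.+1).
  have := below k; have := below k.+1; rewrite /r.
  by have := mono k i; do ?[case: ifP => ?]; lia.
have rN : r (maxn m.+1 (size mu)) = 0.
  rewrite /r; do 3?[case: ifP => ?; first by lia]; apply/eqP; rewrite row_eq0; lia.
have [la row_la] := partition_of_rows _ _ r_decr rN.
exists la.
  split=> [k ki||k /andP[ik km]||k mk]; rewrite ?row_la // /r.
  - by rewrite ki.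
  - by rewrite ltnNge ik km /=; have := below k.+1; lia.
  - by rewrite ltnNge im ltnn eqxx.
  - by do 3?[case: ifP => ?; first by lia].
apply: col_unique => k; rewrite row_la /r.
have := mono k i; have := mono i k.+1; have := below k; have := mono i k.
by do ?[case: ifP => ?]; lia.
Qed.

(** Dually, the row of length n + 1 fits at place i because column n of la stops
    exactly above row i, and the rows at most m are now longer than j. *)
Lemma add_rim_hook i j m n (la : int_partition) :
  (i <= m)%N -> (j <= n)%N -> row_len la m = j -> col_len la n = i ->
  exists2 mu, rim_shift i j m n (row_len mu) (row_len la) & col_len mu j = m.+1.
Proof.
move=> im jn lam lan.
have mono k k' := @row_nonincreasing la k k'.
have right k : (n < row_len la k)%N = (k < i)%N by rewrite ltn_row_col lan.
pose r k := if (k < i)%N then row_len la k else if k == i then n.+1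
            else if (k <= m)%N then (row_len la k.-1).+1 else row_len la k.
have r_decr k : (r k.+1 <= r k)%N.
  have := mono _ _ (leq_pred k); have := mono _ _ (leqnSn k).
  have := right k; have := right k.+1; have := right k.-1; rewrite /r /=.
  by have := mono m k.+1; do ?[case: ifP => ?]; lia.
have rN : r (maxn m.+1 (size la)) = 0.
  rewrite /r; do 3?[case: ifP => ?; first by lia]; apply/eqP; rewrite row_eq0; lia.
have [mu row_mu] := partition_of_rows _ _ r_decr rN.
exists mu.
  split=> [k ki||k /andP[ik km]||k mk]; rewrite ?row_mu // /r.
  - by rewrite ki.
  - by rewrite ltnn eqxx.
  - by do 2?[case: ifP => ?; first by lia]; rewrite km.
  - by do 3?[case: ifP => ?; first by lia].
apply: col_unique => k; rewrite row_mu /r.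
have := mono k m; have := mono k.-1 m; have := mono m k; have := right k.
by do ?[case: ifP => ?]; lia.
Qed.

(** * Hooks as borders of rectangles *)

Definition upper_hook (i j m n : nat) : set cell :=
  [set c | (c.1 = i /\ (j <= c.2 <= n)%N) \/ ((i <= c.1 <= m)%N /\ c.2 = j)].

Definition lower_hook (i j m n : nat) : set cell :=
  [set c | (c.1 = m /\ (j <= c.2 <= n)%N) \/ ((i <= c.1 <= m)%N /\ c.2 = n)].

Lemma upper_hook_ne i j m n :
  (i <= m)%N -> (j <= n)%N -> is_ne_end (upper_hook i j m n) (i, n).
Proof.
move=> im jn; split=> [|[a b]]; rewrite /upper_hook /content /=; first by lia.
by move=> hab /eqP; rewrite xpair_eqE; lia.
Qed.

Lemma upper_hook_sw i j m n :
  (i <= m)%N -> (j <= n)%N -> is_sw_end (upper_hook i j m n) (m, j).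
Proof.
move=> im jn; split=> [|[a b]]; rewrite /upper_hook /content /=; first by lia.
by move=> hab /eqP; rewrite xpair_eqE; lia.
Qed.

Lemma lower_hook_ne i j m n :
  (i <= m)%N -> (j <= n)%N -> is_ne_end (lower_hook i j m n) (i, n).
Proof.
move=> im jn; split=> [|[a b]]; rewrite /lower_hook /content /=; first by lia.
by move=> hab /eqP; rewrite xpair_eqE; lia.
Qed.

Lemma lower_hook_sw i j m n :
  (i <= m)%N -> (j <= n)%N -> is_sw_end (lower_hook i j m n) (m, j).
Proof.
move=> im jn; split=> [|[a b]]; rewrite /lower_hook /content /=; first by lia.
by move=> hab /eqP; rewrite xpair_eqE; lia.
Qed.

Lemma ne_end_unique (h : set cell) (c c' : cell) :
  is_ne_end h c -> is_ne_end h c' -> c = c'.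
Proof.
move=> [hc max_c] [hc' max_c']; apply: contrapT => ne.
by have := max_c c' hc' (nesym ne); have := max_c' c hc ne; lia.
Qed.

Lemma sw_end_unique (h : set cell) (c c' : cell) :
  is_sw_end h c -> is_sw_end h c' -> c = c'.
Proof.
move=> [hc min_c] [hc' min_c']; apply: contrapT => ne.
by have := min_c c' hc' (nesym ne); have := min_c' c hc ne; lia.
Qed.

Lemma upper_hook_inj i j m n i' j' m' n' :
  (i <= m)%N -> (j <= n)%N -> (i' <= m')%N -> (j' <= n')%N ->
  upper_hook i j m n = upper_hook i' j' m' n' ->
  [/\ i = i', j = j', m = m' & n = n'].
Proof.
move=> im jn im' jn' eq_h.
have := upper_hook_ne _ _ _ _ im jn; have := upper_hook_sw _ _ _ _ im jn.
rewrite eq_h => /sw_end_unique/(_ (upper_hook_sw _ _ _ _ im' jn'))[-> ->].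
by move=> /ne_end_unique/(_ (upper_hook_ne _ _ _ _ im' jn'))[-> ->].
Qed.

Lemma lower_hook_inj i j m n i' j' m' n' :
  (i <= m)%N -> (j <= n)%N -> (i' <= m')%N -> (j' <= n')%N ->
  lower_hook i j m n = lower_hook i' j' m' n' ->
  [/\ i = i', j = j', m = m' & n = n'].
Proof.
move=> im jn im' jn' eq_h.
have := lower_hook_ne _ _ _ _ im jn; have := lower_hook_sw _ _ _ _ im jn.
rewrite eq_h => /sw_end_unique/(_ (lower_hook_sw _ _ _ _ im' jn'))[-> ->].
by move=> /ne_end_unique/(_ (lower_hook_ne _ _ _ _ im' jn'))[-> ->].
Qed.

(** A diagonal that meets the rectangle meets each of the two borders in one
    cell, so sliding along diagonals exchanges the borders and fixes contents. *)
Lemma content_set_upper_lower i j m n :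
  (i <= m)%N -> (j <= n)%N ->
  content_set (upper_hook i j m n) = content_set (lower_hook i j m n).
Proof.
move=> im jn; apply/seteqP; split=> _ [[a b] /= hab <-];
  rewrite /upper_hook /lower_hook /= in hab.
- (* (a, b) slides down its diagonal until it meets row m or column n *)
  exists (a + minn (m - a) (n - b), b + minn (m - a) (n - b))%N;
  by rewrite /content /lower_hook /=; lia.
- (* (a, b) slides up its diagonal until it meets row i or column j *)
  exists (a - minn (a - i) (b - j), b - minn (a - i) (b - j))%N;
  by rewrite /content /upper_hook /=; lia.
Qed.

Lemma card_row_segment i a b :
  #|` fset_set [set c : cell | c.1 = i /\ (a <= c.2 < b)%N] | = (b - a)%N.
Proof.
have -> : [set c : cell | c.1 = i /\ (a <= c.2 < b)%N] =
          [set` [fset (i, k) | k in iota a (b - a)]%fset].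
  apply/seteqP; split=> [[x y]|c] /=.
  - case=> -> hy; apply/imfsetP; exists y => //=.
    by rewrite mem_iota; lia.
  - by case/imfsetP => k /=; rewrite mem_iota => hk -> /=; lia.
rewrite set_fsetK card_imfset /=; last by move=> x y [].
by rewrite undup_id ?iota_uniq // size_iota.
Qed.

Lemma card_col_segment j a b :
  #|` fset_set [set c : cell | c.2 = j /\ (a <= c.1 < b)%N] | = (b - a)%N.
Proof.
have -> : [set c : cell | c.2 = j /\ (a <= c.1 < b)%N] =
          [set` [fset (k, j) | k in iota a (b - a)]%fset].
  apply/seteqP; split=> [[x y]|c] /=.
  - case=> -> hy; apply/imfsetP; exists x => //=.
    by rewrite mem_iota; lia.
  - by case/imfsetP => k /=; rewrite mem_iota => hk -> /=; lia.
rewrite set_fsetK card_imfset /=; last by move=> x y [].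
by rewrite undup_id ?iota_uniq // size_iota.
Qed.

Lemma in_diagram_row (la : int_partition) (c : cell) :
  in_diagram la c = (c.2 < row_len la c.1)%N.
Proof. by []. Qed.

Lemma in_diagram_col (la : int_partition) (c : cell) :
  in_diagram la c = (c.1 < col_len la c.2)%N.
Proof. by rewrite -ltn_row_col. Qed.

Lemma internal_hook_rect i j m n (mu : int_partition) :
  (i <= m)%N -> (j <= n)%N -> row_len mu i = n.+1 -> col_len mu j = m.+1 ->
  is_internal_hook_at mu (upper_hook i j m n) (i, j) /\
  hook_type mu (i, j) = (n - j, m - i)%N.
Proof.
move=> im jn mui muj; have in_ij : in_diagram mu (i, j).
  by rewrite in_diagram_row /= mui.
split; last first.
  rewrite /hook_type /arm /leg in_ij; congr pair.
  - rewrite -[RHS](card_row_segment i j.+1 n.+1); congr #|` fset_set _ |.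
    apply/seteqP; split=> -[x y] /=; rewrite in_diagram_row /=.
    + by case=> + ex; rewrite ex mui; lia.
    + by case=> -> hy; rewrite mui; split; lia.
  - rewrite -[RHS](card_col_segment j i.+1 m.+1); congr #|` fset_set _ |.
    apply/seteqP; split=> -[x y] /=; rewrite in_diagram_col /=.
    + by case=> + ey; rewrite ey muj; lia.
    + by case=> -> hx; rewrite muj; split; lia.
split=> //; rewrite /hook in_ij; apply/seteqP; split=> -[x y];
  rewrite /internal_hook /upper_hook /=.
- case=> -[].
  + by move=> -> hy; split; [rewrite in_diagram_row /= mui | ]; lia.
  + by move=> hx ->; split; [rewrite in_diagram_col /= muj | ]; lia.
- case=> + [[ex hy]|[hx ey]].
  + by rewrite in_diagram_row ex /= mui; lia.
  + by rewrite in_diagram_col ey /= muj; lia.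
Qed.

Lemma external_hook_rect i j m n (la : int_partition) :
  (i <= m)%N -> (j <= n)%N -> row_len la m = j -> col_len la n = i ->
  is_external_hook_at la (lower_hook i j m n) (m, n) /\
  hook_type la (m, n) = (n - j, m - i)%N.
Proof.
move=> im jn lam lan; have out_mn : ~~ in_diagram la (m, n).
  by rewrite in_diagram_row /= lam; lia.
split; last first.
  rewrite /hook_type /arm /leg (negbTE out_mn); congr pair.
  - rewrite -[RHS](card_row_segment m j n); congr #|` fset_set _ |.
    apply/seteqP; split=> -[x y] /=; rewrite in_diagram_row /=.
    + by case=> + ex; rewrite ex lam; lia.
    + by case=> -> hy; rewrite lam; split; lia.
  - rewrite -[RHS](card_col_segment n i m); congr #|` fset_set _ |.
    apply/seteqP; split=> -[x y] /=; rewrite in_diagram_col /=.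
    + by case=> + ey; rewrite ey lan; lia.
    + by case=> -> hx; rewrite lan; split; lia.
split=> //; rewrite /hook (negbTE out_mn); apply/seteqP; split=> -[x y];
  rewrite /external_hook /lower_hook /=.
- case=> -[].
  + by move=> -> hy; split; [rewrite in_diagram_row /= lam | ]; lia.
  + by move=> hx ->; split; [rewrite in_diagram_col /= lan | ]; lia.
- case=> + [[ex hy]|[hx ey]].
  + by rewrite in_diagram_row ex /= lam; lia.
  + by rewrite in_diagram_col ey /= lan; lia.
Qed.

Lemma internal_hook_atP (mu : int_partition) (g : set cell) (i j : nat) :
  is_internal_hook_at mu g (i, j) ->
  exists m n, [/\ (i <= m)%N, (j <= n)%N, row_len mu i = n.+1, col_len mu j = m.+1
                & g = upper_hook i j m n].
Proof.
case=> in_ij ->; have := in_ij; rewrite in_diagram_row /= => in_row.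
have := in_ij; rewrite in_diagram_col /= => in_col.
have im : (i <= (col_len mu j).-1)%N by lia.
have jn : (j <= (row_len mu i).-1)%N by lia.
have mui : row_len mu i = (row_len mu i).-1.+1 by lia.
have muj : col_len mu j = (col_len mu j).-1.+1 by lia.
exists (col_len mu j).-1, (row_len mu i).-1; split=> //.
by have [[_ <-] _] := internal_hook_rect _ _ _ _ _ im jn mui muj.
Qed.

Lemma external_hook_atP (la : int_partition) (h : set cell) (m n : nat) :
  is_external_hook_at la h (m, n) ->
  exists i j, [/\ (i <= m)%N, (j <= n)%N, row_len la m = j, col_len la n = i
                & h = lower_hook i j m n].
Proof.
case=> out_mn ->; have := out_mn; rewrite in_diagram_row -leqNgt /= => jn.
have := out_mn; rewrite in_diagram_col -leqNgt /= => im.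
exists (col_len la n), (row_len la m); split=> //.
by have [[_ <-] _] := external_hook_rect _ _ _ _ _ im jn erefl erefl.
Qed.

(** * The bijection *)

(** Matching pairs by a relation avoids extracting the corner of a hook from its
    set of cells: choice turns the relation into a function. *)
Lemma set_bij_of_relation (T : Type) (A B : set T) (R : T -> T -> Prop) :
  (forall x, A x -> exists2 y, B y & R x y) ->
  (forall y, B y -> exists2 x, A x & R x y) ->
  (forall x y y', R x y -> R x y' -> y = y') ->
  (forall x x' y, R x y -> R x' y -> x = x') ->
  exists2 f : T -> T, set_bij A B f & forall x, A x -> R x (f x).
Proof.
move=> totA totB R_fun R_inj.
have tot x : exists y, A x -> B y /\ R x y.
  by have [/totA[y]|] := pselect (A x); [exists y | exists x].
have [f fP] := boolp.choice tot.
exists f; last by move=> x /fP[].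
split=> [x /fP[] //|x x' /set_mem Ax /set_mem Ax' eq_f|y /totB[x Ax Rxy]].
  by have [_ Rx] := fP x Ax; have [_ Rx'] := fP x' Ax'; apply: R_inj Rx _; rewrite eq_f.
by exists x => //; have [_ Rx] := fP x Ax; apply: R_fun Rx Rxy.
Qed.

Definition rim_match (x y : int_partition * set cell) : Prop :=
  exists i j m n,
    [/\ (i <= m)%N, (j <= n)%N & rim_shift i j m n (row_len x.1) (row_len y.1)] /\
    [/\ col_len x.1 j = m.+1, col_len y.1 n = i,
        x.2 = upper_hook i j m n & y.2 = lower_hook i j m n].

Lemma rim_match_total (d l : nat) (x : int_partition * set cell) :
  S_int d l x -> exists2 y, S_ext (d - l) l y & rim_match x y.
Proof.
case: x => mu g [/= szmu [[i j] /[dup] hook_g /internal_hook_atP]].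
move=> [m [n [im jn mui muj g_rect]]] len.
have [la shift lan] := remove_rim_hook _ _ _ _ _ im jn mui muj.
have lam : row_len la m = j by case: shift.
have [hook_h ty_h] := external_hook_rect _ _ _ _ _ im jn lam lan.
have [_ ty_g] := internal_hook_rect _ _ _ _ _ im jn mui muj.
exists (la, lower_hook i j m n); last by exists i, j, m, n.
have := rim_shift_sumn _ _ _ _ _ _ im jn shift.
move: ty_g ty_h len szmu; rewrite /hook_length /partitions_of /= => -[-> ->] ty_h <- <- eq_sz.
split; first by rewrite /partitions_of /=; lia.
by exists (m, n) => //; rewrite /hook_length; case: ty_h => -> ->.
Qed.

Lemma rim_match_onto (d l : nat) (y : int_partition * set cell) :
  (l <= d)%N -> S_ext (d - l) l y -> exists2 x, S_int d l x & rim_match x y.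
Proof.
case: y => la h ld [/= szla [[m n] /[dup] hook_h /external_hook_atP]].
move=> [i [j [im jn lam lan h_rect]]] len.
have [mu shift muj] := add_rim_hook _ _ _ _ _ im jn lam lan.
have mui : row_len mu i = n.+1 by case: shift.
have [hook_g ty_g] := internal_hook_rect _ _ _ _ _ im jn mui muj.
have [_ ty_h] := external_hook_rect _ _ _ _ _ im jn lam lan.
exists (mu, upper_hook i j m n); last by exists i, j, m, n.
have := rim_shift_sumn _ _ _ _ _ _ im jn shift.
move: ty_h len szla; rewrite /hook_length /partitions_of /= => -[-> ->] len szla eq_sz.
split; first by rewrite /partitions_of /=; lia.
by exists (i, j) => //; rewrite /hook_length; case: ty_g => -> ->.
Qed.

(** The two ends of the hook of x give all of i, j, m and n, hence also the hook
    of y, and the row lengths of y are solved from [rim_shift]. *)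
Lemma rim_match_fun x y y' : rim_match x y -> rim_match x y' -> y = y'.
Proof.
case: x y y' => mu g [la h] [la' h'].
move=> [i [j [m [n [[im jn shift] /= [_ _ g_rect ->]]]]]].
move=> [i' [j' [m' [n' [[im' jn' shift'] /= [_ _ g_rect' ->]]]]]].
have [ei ej em en] : [/\ i = i', j = j', m = m' & n = n'].
  by apply: upper_hook_inj; rewrite // -g_rect.
move: shift; rewrite /= ei ej em en => shift.
by congr pair; apply/row_inj/(rim_shift_fun _ _ _ _ _ _ _ shift shift').
Qed.

Lemma rim_match_inj x x' y : rim_match x y -> rim_match x' y -> x = x'.
Proof.
case: x x' y => mu g [mu' g'] [la h].
move=> [i [j [m [n [[im jn shift] /= [_ _ -> h_rect]]]]]].
move=> [i' [j' [m' [n' [[im' jn' shift'] /= [_ _ -> h_rect']]]]]].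
have [ei ej em en] : [/\ i = i', j = j', m = m' & n = n'].
  by apply: lower_hook_inj; rewrite // -h_rect.
move: shift; rewrite /= ei ej em en => shift.
by congr pair; apply/row_inj/(rim_shift_inj _ _ _ _ _ _ _ shift shift').
Qed.

Theorem theorem1p2 (d l : nat) (hl : (0 < l)%N) (hld : (l <= d)%N) :
  exists f : int_partition * set cell -> int_partition * set cell,
    set_bij (S_int d l) (S_ext (d - l)%N l) f /\
    (forall (mu : int_partition) (g : set cell) (la : int_partition) (h : set cell),
       S_int d l (mu, g) -> f (mu, g) = (la, h) ->
       [/\ exists c : cell, is_ne_end g c /\ is_ne_end h c,
           exists c : cell, is_sw_end g c /\ is_sw_end h c,
           content_set g = content_set h
         & forall b b' : cell,
             is_internal_hook_at mu g b -> is_external_hook_at la h b' ->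
             hook_type mu b = hook_type la b']).
Proof.
have [f f_bij fP] := set_bij_of_relation _ _ _ _ (@rim_match_total d l)
  (fun y => @rim_match_onto d l y hld) rim_match_fun rim_match_inj.
exists f; split=> // mu g la h /fP + ef; rewrite {}ef.
move=> [i [j [m [n [[im jn shift] /= [muj lan -> ->]]]]]].
split.
- by exists (i, n); split; [exact: upper_hook_ne | exact: lower_hook_ne].
- by exists (m, j); split; [exact: upper_hook_sw | exact: lower_hook_sw].
- exact: content_set_upper_lower.
move=> [b1 b2] [c1 c2] /internal_hook_atP[m' [n' [im' jn' mui' muj' eq_g]]].
move=> /external_hook_atP[i'' [j'' [im'' jn'' lam'' lan'' eq_h]]].
have [_ ->] := internal_hook_rect _ _ _ _ _ im' jn' mui' muj'.
have [_ ->] := external_hook_rect _ _ _ _ _ im'' jn'' lam'' lan''.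
have [<- <- <- <-] := upper_hook_inj _ _ _ _ _ _ _ _ im jn im' jn' eq_g.
by have [<- <- <- <-] := lower_hook_inj _ _ _ _ _ _ _ _ im jn im'' jn'' eq_h.
Qed.
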